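(* Let $\varphi\in L^\infty(\mathbb{D})$. Then the dual Toeplitz operator $S_\varphi$ is hyponormal on $(L_h^2)^\perp$ if and only if it is normal.
   Context: $\mathbb{D}$ is the open unit disk in $\mathbb{C}$, $dA=\frac1\pi\,dx\,dy$ is normalized area measure, and $L^2(\mathbb{D})=L^2(\mathbb{D},dA)$ is the space of (complex-valued) square-integrable functions with inner product $\langle f,g\rangle=\int_{\mathbb{D}} f\overline{g}\,dA$. $L_h^2$ is the harmonic Bergman space, i.e. the closed subspace of $L^2(\mathbb{D})$ consisting of all (complex-valued) harmonic functions on $\mathbb{D}$ in $L^2(\mathbb{D})$; $(L_h^2)^\perp$ is its orthogonal complement in $L^2(\mathbb{D})$, and $Q$ is the orthogonal projection of $L^2(\mathbb{D})$ onto $L_h^2$. For $\varphi\in L^\infty(\mathbb{D})$, the dual Toeplitz operator $S_\varphi$ with symbol $\varphi$ is the bounded linear operator on $(L_h^2)^\perp$ given by $S_\varphi u=(I-Q)(\varphi u)$. A bounded operator $T$ on a Hilbert space is hyponormal if $T^*T-TT^*\geqslant 0$, and normal if $T^*T=TT^*$. *)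

(* Defs.v *)
From HB Require Import structures.
From mathcomp Require Import all_boot all_order all_algebra.
From mathcomp Require Import all_classical all_reals all_analysis.
From mathcomp Require Import complex.

Set Implicit Arguments.
Unset Strict Implicit.
Unset Printing Implicit Defensive.

Import Order.TTheory GRing.Theory Num.Theory numFieldNormedType.Exports.

Local Open Scope classical_set_scope.
Local Open Scope complex_scope.
Local Open Scope ring_scope.

(* (x, y) : R * R stands for x + iy.  Elements of L^2(D) and L^oo(D) are
   represented by functions R * R -> R[i]: only the values on the disk matter,
   and functions that agree almost everywhere there (aeq) are identified. *)
Definition disk (R : realType) : set (R * R) :=
  [set z | z.1 ^+ 2 + z.2 ^+ 2 < 1].
Arguments disk : clear implicits.

Lemma invr_pi_ge0 (R : realType) : 0 <= (pi : R)^-1.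
Proof. by rewrite invr_ge0 pi_ge0. Qed.

Definition dA (R : realType) :
    {measure set (measurableTypeR R * measurableTypeR R) -> \bar R} :=
  mscale (NngNum (invr_pi_ge0 R)) (lebesgue_measure \x lebesgue_measure)%E.
Arguments dA : clear implicits.

Definition aeq (R : realType) (f g : R * R -> R[i]) : Prop :=
  f = g %[ae dA R in disk R].

(* The L^p(D, dA)-norm; the restriction to the disk extends by 0. *)
Definition norm_disk (R : realType) (p : \bar R) (f : R * R -> R[i]) : \bar R :=
  ('N[dA R]_p[(fun z => (Normc.normc (f z))%:E) \_ (disk R)])%E.

Definition Lp_disk (R : realType) (p : \bar R) : set (R * R -> R[i]) :=
  [set f | [/\ measurable_fun (disk R) (fun z => complex.Re (f z)),
               measurable_fun (disk R) (fun z => complex.Im (f z)) &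
               (norm_disk p f < +oo)%E]].

Definition inner_disk (R : realType) (f g : R * R -> R[i]) : R[i] :=
  (\int[dA R]_(z in disk R) complex.Re (f z * (g z)^*)) +i*
  (\int[dA R]_(z in disk R) complex.Im (f z * (g z)^*)).

Definition C2_disk (R : realType) (u : R * R -> R) : Prop :=
  forall z, disk R z ->
    {for z, continuous u} /\
    forall v, v \in [:: (1, 0); (0, 1)] ->
      [/\ derivable u z v, {for z, continuous ('D_v u)} &
        forall w, w \in [:: (1, 0); (0, 1)] ->
          derivable ('D_v u) z w /\ {for z, continuous ('D_w ('D_v u))}].

Definition laplacian (R : realType) (u : R * R -> R) (z : R * R) : R :=
  'D_(1, 0) ('D_(1, 0) u) z + 'D_(0, 1) ('D_(0, 1) u) z.

Definition real_harmonic (R : realType) (u : R * R -> R) : Prop :=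
  C2_disk u /\ forall z, disk R z -> laplacian u z = 0.

Definition complex_harmonic (R : realType) (f : R * R -> R[i]) : Prop :=
  real_harmonic (fun z => complex.Re (f z)) /\
  real_harmonic (fun z => complex.Im (f z)).

Definition L2h (R : realType) : set (R * R -> R[i]) :=
  [set f | Lp_disk 2%:E f /\ complex_harmonic f].

Definition L2h_perp (R : realType) : set (R * R -> R[i]) :=
  [set f | Lp_disk 2%:E f /\ forall g, L2h g -> inner_disk f g = 0].
Arguments L2h_perp : clear implicits.

(* The orthogonal projection of L^2(D) onto L^2_h: the h in L^2_h with
   f - h orthogonal to L^2_h, which is unique on the disk; the default value 0
   is junk, for f outside L^2(D). *)
Definition proj_L2h (R : realType) (f : R * R -> R[i]) : R * R -> R[i] :=
  xget (cst 0) [set h | L2h h /\ forall g, L2h g -> inner_disk (f \- h) g = 0].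

Definition dual_toeplitz (R : realType) (phi u : R * R -> R[i]) :
    R * R -> R[i] :=
  (phi \* u) \- proj_L2h (phi \* u).

(* Operators on a closed subspace H of L^2(D) act on representatives; linearity
   and boundedness make them compatible with aeq. *)
Definition bounded_operator (R : realType) (H : set (R * R -> R[i]))
    (T : (R * R -> R[i]) -> (R * R -> R[i])) : Prop :=
  [/\ forall u, H u -> H (T u),
      forall (a : R[i]) u v, H u -> H v ->
        aeq (T (fun z => a * u z + v z)) (fun z => a * T u z + T v z) &
      exists M : R, forall u, H u ->
        (norm_disk 2%:E (T u) <= M%:E * norm_disk 2%:E u)%E].

Definition is_adjoint (R : realType) (H : set (R * R -> R[i]))
    (T T' : (R * R -> R[i]) -> (R * R -> R[i])) : Prop :=
  bounded_operator H T' /\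
  forall u v, H u -> H v -> inner_disk (T u) v = inner_disk u (T' v).

(* A bounded operator has an adjoint, unique up to aeq, so the existential
   below only names T^*. *)
Definition hyponormal (R : realType) (H : set (R * R -> R[i]))
    (T : (R * R -> R[i]) -> (R * R -> R[i])) : Prop :=
  bounded_operator H T /\
  exists2 T', is_adjoint H T T' &
    forall u, H u -> 0 <= inner_disk (T' (T u) \- T (T' u)) u.

Definition normal_operator (R : realType) (H : set (R * R -> R[i]))
    (T : (R * R -> R[i]) -> (R * R -> R[i])) : Prop :=
  bounded_operator H T /\
  exists2 T', is_adjoint H T T' &
    forall u, H u -> aeq (T' (T u)) (T (T' u)).

(* Main.v *)
Require Import Defs.
From mathcomp Require Import all_boot all_order all_algebra.
From mathcomp Require Import all_classical all_reals all_analysis.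
From mathcomp Require Import measurable_realfun complex.
From mathcomp Require Import ring lra.

(** Write T for the dual Toeplitz operator with symbol phi and H for the
    orthogonal complement of the harmonic Bergman space. The theorem is a
    consequence of the symmetry of H under complex conjugation J u = u^*: the
    real and imaginary parts of a harmonic function are harmonic, so J preserves
    the harmonic Bergman space, and therefore also H (perp_conj).

    On H the projection is invisible to inner products, <T u, v> = <phi u, v>
    (inner_toeplitz). Moving the conjugations around in the integral of
    phi u^* v^* gives <T (J u), v> = <T (J v), u>
    (toeplitz_complex_symmetric): T is a complex symmetric operator, and its
    adjoint is T' = J T J (adjoint_conj). As J preserves norms,
    |T' u| = |T (J u)|.

    Hyponormality says that D u = |T u|^2 - |T' u|^2 is nonnegative on H. By the
    preceding identity D (J u) = - D u (commutator_conj), so D vanishes on H.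
    The self-commutator N = T' T - T T' is symmetric and has the quadratic form
    D, so it vanishes (symmetric_form_eq0), which is normality. The converse
    holds because a commutator that vanishes almost everywhere has the zero
    quadratic form. *)

Set Implicit Arguments.
Unset Strict Implicit.
Unset Printing Implicit Defensive.

Import Order.TTheory GRing.Theory Num.Theory numFieldNormedType.Exports.

Local Open Scope classical_set_scope.
Local Open Scope complex_scope.
Local Open Scope ring_scope.

(** * Square-integrable functions on the disk *)

Section SquareIntegrable.
Variable R : realType.
Implicit Types f g h : R * R -> R[i].

(** The squared modulus, as a polynomial in the real and imaginary parts: this
    form makes measurability and pointwise bounds elementary. *)
Definition sqmod f (z : R * R) : R :=
  complex.Re (f z) ^+ 2 + complex.Im (f z) ^+ 2.

Lemma sqmod_ge0 f z : 0 <= sqmod f z.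
Proof. by rewrite addr_ge0 ?sqr_ge0. Qed.

Lemma measurable_disk :
  measurable (disk R : set (measurableTypeR R * measurableTypeR R)).
Proof.
(* the disk is a strict sublevel set of a measurable function *)
have -> : disk R = (fun z : measurableTypeR R * measurableTypeR R =>
    z.1 ^+ 2 + z.2 ^+ 2) @^-1` `]-oo, 1[%classic.
  by apply/seteqP; split => z /=; rewrite in_itv.
rewrite -[X in measurable X]setTI.
apply: (measurable_funD _ _ measurableT) => //; apply: measurable_funX.
- exact: measurable_fst.
- exact: measurable_snd.
Qed.
Hint Resolve measurable_disk : core.

(** Replaces the finiteness of a norm by an integrability statement, the form in
    which domination arguments apply. *)
Lemma Lp_disk2P f : Lp_disk 2%:E f <->
  [/\ measurable_fun (disk R) (fun z => complex.Re (f z)),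
      measurable_fun (disk R) (fun z => complex.Im (f z)) &
      (dA R).-integrable (disk R) (EFin \o sqmod f)].
Proof.
rewrite /Lp_disk /= /norm_disk.
have n0 : (2 : R) != 0 by [].
have E : (\int[dA R]_z
    `|((fun z => (Normc.normc (f z))%:E) \_ (disk R)) z| `^ 2)%E =
    (\int[dA R]_(z in disk R) (sqmod f z)%:E)%E.
  rewrite [RHS]integral_mkcond; apply: eq_integral => z _.
  rewrite !patchE; case: ifP => _; last first.
    by rewrite abse0 poweR0r.
  rewrite /sqmod; case: (f z) => a b /=.
  rewrite ger0_norm ?sqrtr_ge0// powR_mulrn ?sqrtr_ge0// sqr_sqrtr//.
  by rewrite addr_ge0 ?sqr_ge0.
split => -[mr mi fin]; split => //.
- apply/integrableP; split.
    apply/measurable_EFinP.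
    by apply: measurable_funD; apply: measurable_funX.
  under eq_integral => z _ do rewrite /= ger0_norm ?sqmod_ge0//.
  by rewrite -E -poweR_Lnorm// poweR_lty.
- apply: (lty_poweRy n0); rewrite poweR_Lnorm// E.
  exact: integrable_lty fin.
Qed.

Lemma integrable_dominated2 f g (k : R * R -> R) :
  Lp_disk 2%:E f -> Lp_disk 2%:E g -> measurable_fun (disk R) k ->
  (forall z, `|k z| <= 2 * (sqmod f z + sqmod g z)) ->
  (dA R).-integrable (disk R) (EFin \o k).
Proof.
move=> /Lp_disk2P[_ _ fi] /Lp_disk2P[_ _ gi] mk le_k.
have := integrableZl measurable_disk 2 (integrableD measurable_disk fi gi).
apply: le_integrable => //; first exact/measurable_EFinP.
move=> z _ /=; rewrite lee_fin (le_trans (le_k z))// ler_norm//.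
Qed.

Lemma Lp_disk2_lin (a : R[i]) f g : Lp_disk 2%:E f -> Lp_disk 2%:E g ->
  Lp_disk 2%:E (fun z => a * f z + g z).
Proof.
move=> Lf Lg; have [fr fi If] := (Lp_disk2P f).1 Lf.
have [gr gi Ig] := (Lp_disk2P g).1 Lg.
case: a => a b; apply/Lp_disk2P.
have mR : measurable_fun (disk R)
    (fun z => complex.Re ((a +i* b) * f z + g z)).
  rewrite (_ : (fun z => _) = fun z => a * complex.Re (f z)
     - b * complex.Im (f z) + complex.Re (g z)).
    apply: measurable_funD => //; apply: measurable_funB;
      exact: measurable_funM.
  by apply/funext => z; case: (f z) (g z) => ? ? [].
have mI : measurable_fun (disk R)
    (fun z => complex.Im ((a +i* b) * f z + g z)).
  rewrite (_ : (fun z => _) = fun z => a * complex.Im (f z)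
     + b * complex.Re (f z) + complex.Im (g z)).
    apply: measurable_funD => //; apply: measurable_funD;
      exact: measurable_funM.
  by apply/funext => z; case: (f z) (g z) => ? ? [].
split => //.
have Ib := integrableD measurable_disk
  (integrableZl measurable_disk (2 * (a ^+ 2 + b ^+ 2)) If)
  (integrableZl measurable_disk 2 Ig).
apply: le_integrable Ib => //.
  by apply/measurable_EFinP; apply: measurable_funD; apply: measurable_funX.
move=> z _ /=; rewrite lee_fin [leLHS]ger0_norm ?sqmod_ge0//.
apply: le_trans (ler_norm _); rewrite /sqmod.
case: (f z) (g z) => x y [u v] /=; rewrite -subr_ge0.
(* the parallelogram inequality |p + q|^2 <= 2 |p|^2 + 2 |q|^2, whose defect is
   |p - q|^2 *)
rewrite (_ : _ - _ = (a * x - b * y - u) ^+ 2 + (a * y + b * x - v) ^+ 2).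
  by rewrite addr_ge0 ?sqr_ge0.
by ring.
Qed.

Lemma cauchy_bound (x y u v : R) :
  `|x * u + y * v| <= 2 * ((x ^+ 2 + y ^+ 2) + (u ^+ 2 + v ^+ 2)).
Proof.
have h1 := sqr_ge0 (x + u); have h2 := sqr_ge0 (y + v).
have h3 := sqr_ge0 (x - u); have h4 := sqr_ge0 (y - v).
have h5 := sqr_ge0 x; have h6 := sqr_ge0 y.
have h7 := sqr_ge0 u; have h8 := sqr_ge0 v.
by rewrite ler_norml; apply/andP; split; lra.
Qed.

Lemma integrable_inner f g : Lp_disk 2%:E f -> Lp_disk 2%:E g ->
  (dA R).-integrable (disk R) (EFin \o (fun z => complex.Re (f z * (g z)^*))) /\
  (dA R).-integrable (disk R) (EFin \o (fun z => complex.Im (f z * (g z)^*))).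
Proof.
move=> Lf Lg; have [fr fi _] := Lf; have [gr gi _] := Lg.
split; apply: (integrable_dominated2 Lf Lg).
- rewrite (_ : (fun z => _) = fun z => complex.Re (f z) * complex.Re (g z)
     + complex.Im (f z) * complex.Im (g z)).
    by apply: measurable_funD; apply: measurable_funM.
  by apply/funext => z; case: (f z) (g z) => ? ? [? ?] /=; ring.
- move=> z; rewrite /sqmod; case: (f z) (g z) => x y [u v] /=.
  rewrite (_ : _ - _ = x * u + y * v); first exact: cauchy_bound.
  by ring.
- rewrite (_ : (fun z => _) = fun z => complex.Im (f z) * complex.Re (g z)
     - complex.Re (f z) * complex.Im (g z)).
    by apply: measurable_funB; apply: measurable_funM.
  by apply/funext => z; case: (f z) (g z) => ? ? [? ?] /=; ring.
- move=> z; rewrite /sqmod; case: (f z) (g z) => x y [u v] /=.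
  have -> : x * - v + y * u = y * u + (- x) * v by ring.
  by rewrite [x ^+ 2 + _]addrC -(sqrrN x); exact: cauchy_bound.
Qed.

Lemma integrable_disk_lin (a b : R) (k l : R * R -> R) :
  (dA R).-integrable (disk R) (EFin \o k) ->
  (dA R).-integrable (disk R) (EFin \o l) ->
  (dA R).-integrable (disk R) (EFin \o (fun z => a * k z + b * l z)).
Proof.
move=> Ik Il; exact: (integrableD measurable_disk
  (integrableZl measurable_disk a Ik) (integrableZl measurable_disk b Il)).
Qed.

Lemma Rintegral_disk_lin (a b : R) (k l : R * R -> R) :
  (dA R).-integrable (disk R) (EFin \o k) ->
  (dA R).-integrable (disk R) (EFin \o l) ->
  \int[dA R]_(z in disk R) (a * k z + b * l z) =
  a * (\int[dA R]_(z in disk R) k z) + b * (\int[dA R]_(z in disk R) l z).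
Proof.
move=> Ik Il; rewrite RintegralD ?RintegralZl//.
- exact: (integrableZl measurable_disk a Ik).
- exact: (integrableZl measurable_disk b Il).
Qed.

Lemma inner_disk_linl (a : R[i]) f g h : Lp_disk 2%:E f -> Lp_disk 2%:E g ->
  Lp_disk 2%:E h ->
  inner_disk (fun z => a * f z + g z) h = a * inner_disk f h + inner_disk g h.
Proof.
move=> Lf Lg Lh.
have [fr fi] := integrable_inner Lf Lh; have [gr gi] := integrable_inner Lg Lh.
case: a => a b; rewrite /inner_disk; apply/eqP; rewrite eq_complex /=.
apply/andP; split; apply/eqP.
- rewrite -mulNr -Rintegral_disk_lin// -[X in _ = _ + X]mul1r.
  rewrite -[X in _ = X + _]mul1r -Rintegral_disk_lin//; last first.
    exact: integrable_disk_lin.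
  apply: eq_Rintegral => z _; case: (f z) (g z) (h z) => ? ? [? ?] [? ?] /=.
  by ring.
- rewrite -Rintegral_disk_lin// -[X in _ = _ + X]mul1r.
  rewrite -[X in _ = X + _]mul1r -Rintegral_disk_lin//; last first.
    exact: integrable_disk_lin.
  apply: eq_Rintegral => z _; case: (f z) (g z) (h z) => ? ? [? ?] [? ?] /=.
  by ring.
Qed.

Lemma inner_disk_conj f g : Lp_disk 2%:E f -> Lp_disk 2%:E g ->
  inner_disk g f = (inner_disk f g)^*.
Proof.
move=> Lf Lg; have [fr fi] := integrable_inner Lf Lg.
have mD := measurable_disk.
rewrite /inner_disk; apply/eqP; rewrite eq_complex /=; apply/andP; split.
  apply/eqP; apply: eq_Rintegral => z _.
  by case: (f z) (g z) => ? ? [? ?] /=; ring.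
rewrite -mulN1r -RintegralZl//; apply/eqP/eq_Rintegral => z _.
by case: (f z) (g z) => ? ? [? ?] /=; ring.
Qed.

(** Conjugation is antiunitary, and so exchanges the arguments. *)
Lemma inner_disk_conjJ f g :
  inner_disk (fun z => (f z)^*) (fun z => (g z)^*) = inner_disk g f.
Proof.
by rewrite /inner_disk; congr (_ +i* _); apply: eq_Rintegral => z _;
  case: (f z) (g z) => ? ? [? ?] /=; ring.
Qed.

Lemma Lp_disk2_conj f : Lp_disk 2%:E f -> Lp_disk 2%:E (fun z => (f z)^*).
Proof.
move=> /Lp_disk2P[mr mi If]; apply/Lp_disk2P; split.
- by rewrite (_ : (fun z => _) = fun z => complex.Re (f z))//;
    apply/funext => z; case: (f z).
- rewrite (_ : (fun z => _) = \- (fun z => complex.Im (f z))); last first.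
    by apply/funext => z /=; case: (f z).
  exact: measurable_funN.
- rewrite (_ : sqmod _ = sqmod f)//; apply/funext => z.
  by rewrite /sqmod; case: (f z) => a b /=; rewrite sqrrN.
Qed.

(** The filter structure of the almost everywhere quantifier is attached to the
    product of measurable types; on the bare carrier R * R it is not inferred
    and is given explicitly here. *)
Lemma ae_disk_imply (P Q : R * R -> Prop) : (forall z, P z -> Q z) ->
  (\forall z \ae dA R, disk R z -> P z) -> \forall z \ae dA R, disk R z -> Q z.
Proof.
move=> PQ; apply: (@filterS _ _ (ae_filter_ringOfSetsType (dA R))) => z Pz Dz.
exact/PQ/Pz.
Qed.

Lemma inner_disk_eq0 f : Lp_disk 2%:E f -> inner_disk f f = 0 ->
  aeq f (cst 0).
Proof.
move=> /Lp_disk2P[mr mi If] /eqP; rewrite eq_complex /= => /andP[/eqP f0 _].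
have mD := measurable_disk.
have /(ae_eq_integral_abs (dA R) mD (measurable_int _ If)) :
    (\int[dA R]_(z in disk R) `|(EFin \o sqmod f) z| = 0)%E.
  rewrite -[RHS]/((0 : R)%:E) -f0 /Rintegral fineK.
    apply: eq_integral => z _ /=; rewrite ger0_norm ?sqmod_ge0//.
    by congr EFin; rewrite /sqmod; case: (f z) => a b /=; ring.
  apply: integrable_fin_num => //.
  by have Lf : Lp_disk 2%:E f; [apply/Lp_disk2P|case: (integrable_inner Lf Lf)].
apply: ae_disk_imply => z [].
rewrite /sqmod; case: (f z) => a b /= /eqP.
by rewrite paddr_eq0 ?sqr_ge0// !sqrf_eq0 => /andP[/eqP -> /eqP ->].
Qed.

(** Square integrability of f and g supplies the measurability needed to replace
    the integrand by an almost everywhere equal one. *)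
Lemma aeq_inner_disk0 f g : Lp_disk 2%:E f -> Lp_disk 2%:E g ->
  aeq f (cst 0) -> inner_disk f g = 0.
Proof.
move=> Lf Lg f0; have [fr fi] := integrable_inner Lf Lg.
have mD := measurable_disk.
have k0 (k : R[i] -> R) : k 0 = 0 ->
    \forall z \ae dA R, disk R z -> (k (f z * (g z)^*))%:E = 0%E.
  by move=> k0; apply: ae_disk_imply f0 => z ->; rewrite mul0r k0.
rewrite /inner_disk /Rintegral; apply/eqP; rewrite eq_complex /=.
rewrite (ae_eq_integral (cst 0%E) _ mD (measurable_int _ fr) _ (k0 _ erefl))//.
rewrite (ae_eq_integral (cst 0%E) _ mD (measurable_int _ fi) _ (k0 _ erefl))//.
by rewrite integral0 eqxx.
Qed.

End SquareIntegrable.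

(** * Harmonic functions and conjugation *)

Section Harmonic.
Variable R : realType.

Lemma real_harmonic0 : real_harmonic (fun _ : R * R => 0 : R).
Proof.
have D0 v : 'D_v (fun _ : R * R => 0 : R) = fun _ => 0.
  by apply/funext => z; exact: derive_cst.
split=> z _; last first.
  by rewrite /laplacian !D0 !derive_cst addr0.
have C0 : {for z, continuous (fun _ : R * R => 0 : R)} by exact: cvg_cst.
split=> // v _; rewrite D0.
  split; [exact: derivable_cst|exact: C0|].
by move=> w _; rewrite D0; split; [exact: derivable_cst|exact: C0].
Qed.

(** An equality of functions on the whole plane: where u has no derivative in
    the direction v, both sides take the default value 0 of a divergent limit.
    Iterated derivatives can then be rewritten without restriction to the
    disk. *)
Lemma derive_opp (u : R * R -> R) v :
  'D_v (fun z => - u z) = fun z => - 'D_v u z.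
Proof.
apply/funext => z.
have [du|ndu] := pselect (derivable u z v); first exact: deriveN.
have ndNu : ~ derivable (fun z => - u z) z v.
  move=> /derivableN; rewrite (_ : - _ = u)//.
  by apply/funext => x; exact: opprK.
by rewrite /derive (dvgP ndu) (dvgP ndNu) oppr0.
Qed.

Lemma real_harmonicN (u : R * R -> R) :
  real_harmonic u -> real_harmonic (fun z => - u z).
Proof.
have CN (w : R * R -> R) z : {for z, continuous w} ->
    {for z, continuous (fun z => - w z)} by exact: continuousN.
move=> [C2 Lu]; split=> z Dz; last first.
  have DN v w : 'D_w ('D_v (fun x => - u x)) z = - 'D_w ('D_v u) z.
    rewrite derive_opp.
    exact: (congr1 (fun d => d z) (derive_opp ('D_v u) w)).
  by rewrite /laplacian !DN -opprD -[X in - X]/(laplacian u z) Lu// oppr0.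
have [Cu Du] := C2 z Dz; split; first exact: CN.
move=> v /Du[du cDu ddu]; rewrite derive_opp.
split; [exact: derivableN|exact: CN|].
move=> w /ddu[dw cw]; split; first exact: derivableN.
have -> : 'D_w (fun x => - 'D_v u x) = fun x => - 'D_w ('D_v u) x.
  exact: derive_opp.
exact: CN.
Qed.

Lemma L2h0 : L2h (cst 0 : R * R -> R[i]).
Proof.
split; last by split; exact: real_harmonic0.
apply/Lp_disk2P; split; try exact: measurable_cst.
rewrite (_ : EFin \o _ = cst 0%E); first exact: integrable0.
by apply/funext => z; rewrite /sqmod /= expr0n addr0.
Qed.

Lemma L2h_conj (f : R * R -> R[i]) : L2h f -> L2h (fun z => (f z)^*).
Proof.
move=> [Lf [hr hi]]; split; [exact: Lp_disk2_conj|split].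
- by rewrite (_ : (fun z => _) = fun z => complex.Re (f z))//;
    apply/funext => z; case: (f z).
- rewrite (_ : (fun z => _) = fun z => - complex.Im (f z)).
    exact: real_harmonicN.
  by apply/funext => z; case: (f z).
Qed.

End Harmonic.

(** * The complement of the harmonic Bergman space *)

Section Perp.
Variable R : realType.
Implicit Types f g h u v : R * R -> R[i].
Local Notation H := (L2h_perp R).

Lemma inner_disk_linr (a : R[i]) f g h : Lp_disk 2%:E f -> Lp_disk 2%:E g ->
  Lp_disk 2%:E h ->
  inner_disk h (fun z => a * f z + g z) =
  a^* * inner_disk h f + inner_disk h g.
Proof.
move=> Lf Lg Lh; rewrite inner_disk_conj//; last exact: Lp_disk2_lin.
rewrite inner_disk_linl// (inner_disk_conj Lh Lf) (inner_disk_conj Lh Lg).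
by rewrite rmorphD rmorphM /= !conjCK.
Qed.

Lemma perp_L2 f : H f -> Lp_disk 2%:E f. Proof. by case. Qed.

Lemma perp_lin (a : R[i]) f g : H f -> H g -> H (fun z => a * f z + g z).
Proof.
move=> [Lf Pf] [Lg Pg]; split; first exact: Lp_disk2_lin.
by move=> h hh; rewrite inner_disk_linl ?Pf ?Pg ?mulr0 ?addr0//; case: hh.
Qed.

Lemma perp_sub f g : H f -> H g -> H (f \- g).
Proof.
move=> Hf Hg; rewrite (_ : f \- g = fun z => -1 * g z + f z).
  exact: perp_lin.
by apply/funext => z /=; rewrite mulN1r addrC.
Qed.

Lemma inner_disk_subl f g h : Lp_disk 2%:E f -> Lp_disk 2%:E g ->
  Lp_disk 2%:E h -> inner_disk (f \- g) h = inner_disk f h - inner_disk g h.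
Proof.
move=> Lf Lg Lh; rewrite (_ : f \- g = fun z => -1 * g z + f z).
  by rewrite inner_disk_linl// mulN1r addrC.
by apply/funext => z /=; rewrite mulN1r addrC.
Qed.

Lemma perp_conj f : H f -> H (fun z => (f z)^*).
Proof.
move=> [Lf Pf]; split; first exact: Lp_disk2_conj.
move=> g Lg; have /Pf := L2h_conj Lg.
rewrite -inner_disk_conjJ (_ : (fun z => _) = g); last first.
  by apply/funext => z; rewrite conjCK.
move=> P0; rewrite inner_disk_conj ?P0 ?conjC0//; last exact: Lp_disk2_conj.
by case: Lg.
Qed.

(** For w = N u, expanding <N (u + w), u + w> = 0 by symmetry leaves the two
    cross terms <N u, w> and <N w, u>, both equal to <w, w>. *)
Lemma symmetric_form_eq0 (N : (R * R -> R[i]) -> R * R -> R[i]) :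
  (forall u, H u -> H (N u)) ->
  (forall u v, H u -> H v -> inner_disk (N u) v = inner_disk u (N v)) ->
  (forall u, H u -> inner_disk (N u) u = 0) ->
  forall u, H u -> aeq (N u) (cst 0).
Proof.
move=> HN symN N0 u Hu; have HNu := HN _ Hu; have HNNu := HN _ HNu.
have [Lu LNu LNNu] := And3 (perp_L2 Hu) (perp_L2 HNu) (perp_L2 HNNu).
have Hs := perp_lin 1 Hu HNu.
apply: inner_disk_eq0 => //; have := N0 _ Hs.
rewrite (inner_disk_linr 1 Lu LNu (perp_L2 (HN _ Hs))) conjC1 mul1r.
rewrite (symN _ _ Hs Hu) (symN _ _ Hs HNu).
rewrite (inner_disk_linl 1 Lu LNu LNu) (inner_disk_linl 1 Lu LNu LNNu) !mul1r.
rewrite -(symN _ _ Hu Hu) (N0 _ Hu) -(symN _ _ HNu HNu) (N0 _ HNu).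
rewrite -(symN _ _ Hu HNu) add0r addr0 => /eqP.
by rewrite -mulr2n mulrn_eq0 /= => /eqP.
Qed.

(** * Conjugation symmetry of dual Toeplitz operators *)

Section Symmetry.
Variable phi : R * R -> R[i].
Local Notation T := (dual_toeplitz phi).
Hypothesis bT : bounded_operator H T.

(** The subtracted projection is orthogonal to v. Since T maps H into itself,
    phi u is the sum of T u and an element of the harmonic Bergman space, which
    makes it square integrable, so the inner product splits. *)
Lemma inner_toeplitz u v : H u -> H v ->
  inner_disk (T u) v = inner_disk (phi \* u) v.
Proof.
move=> Hu Hv; have HTu : H (T u) by case: bT => + _ _; exact.
have Lp : L2h (proj_L2h (phi \* u)).
  (* the default value of the projection is the harmonic function 0 *)
  rewrite /proj_L2h; case: xgetP => [h _ [] //|_]; exact: L2h0.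
have -> : phi \* u = fun z => 1 * proj_L2h (phi \* u) z + T u z.
  by apply/funext => z; rewrite mul1r /dual_toeplitz /= addrC subrK.
have [Lv Pv] := Hv.
rewrite inner_disk_linl//; [|by case: Lp|exact: perp_L2].
rewrite [X in _ = _ * X + _](inner_disk_conj Lv); last by case: Lp.
by rewrite Pv// conjC0 mulr0 add0r.
Qed.

(** Both sides are the integral of phi u^* v^*, symmetric in u and v. *)
Lemma toeplitz_complex_symmetric u v : H u -> H v ->
  inner_disk (T (fun z => (u z)^*)) v = inner_disk (T (fun z => (v z)^*)) u.
Proof.
move=> Hu Hv; rewrite !inner_toeplitz//; try exact: perp_conj.
by rewrite /inner_disk; congr (_ +i* _); apply: eq_Rintegral => z _;
  rewrite /= -!mulrA [(u z)^* * _]mulrC.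
Qed.

Variable T' : (R * R -> R[i]) -> R * R -> R[i].
Hypothesis adjT : is_adjoint H T T'.

Let HT u : H u -> H (T u). Proof. by case: bT => + _ _; exact. Qed.
Let HT' u : H u -> H (T' u). Proof. by case: adjT => -[+ _ _] _; exact. Qed.

Lemma inner_adjointl u v : H u -> H v ->
  inner_disk (T' u) v = inner_disk u (T v).
Proof.
move=> Hu Hv; have [LT'u LTv] := (perp_L2 (HT' Hu), perp_L2 (HT Hv)).
rewrite (inner_disk_conj (perp_L2 Hv) LT'u) -adjT.2//.
by rewrite -(inner_disk_conj LTv (perp_L2 Hu)).
Qed.

(** The adjoint of T is J T J, where J is the conjugation: <T' u, v> = <u, T v>
    is the conjugate of <T v, u>, to which complex symmetry applies once v is
    written as the conjugate of v^*. The equality is tested against H, since an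
    adjoint is determined only almost everywhere. *)
Lemma adjoint_conj u v : H u -> H v ->
  inner_disk (T' u) v =
  inner_disk (fun z => (T (fun z => (u z)^*) z)^*) v.
Proof.
move=> Hu Hv; have Hu' := perp_conj Hu; have Hv' := perp_conj Hv.
have vJJ : v = fun z => ((v z)^*)^* by apply/funext => z; rewrite conjCK.
have [LTv LTJu] := (perp_L2 (HT Hv), perp_L2 (HT Hu')).
rewrite inner_adjointl// (inner_disk_conj LTv (perp_L2 Hu)) {1}vJJ.
rewrite -(toeplitz_complex_symmetric Hu Hv').
rewrite -(inner_disk_conj LTJu (perp_L2 Hv')).
by rewrite [in RHS]vJJ inner_disk_conjJ.
Qed.

Lemma adjoint_norm u : H u ->
  inner_disk (T' u) (T' u) =
  inner_disk (T (fun z => (u z)^*)) (T (fun z => (u z)^*)).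
Proof.
move=> Hu; have HTJ := HT (perp_conj Hu); have HJTJ := perp_conj HTJ.
have HT'u := HT' Hu.
rewrite adjoint_conj// (inner_disk_conj (perp_L2 HT'u) (perp_L2 HJTJ)).
rewrite adjoint_conj// -(inner_disk_conj (perp_L2 HJTJ) (perp_L2 HJTJ)).
exact: inner_disk_conjJ.
Qed.

Local Notation N u := (T' (T u) \- T (T' u)).

Lemma perp_commutator u : H u -> H (N u).
Proof. by move=> Hu; apply: perp_sub; [exact/HT'/HT|exact/HT/HT']. Qed.

Lemma inner_commutator u v : H u -> H v -> inner_disk (N u) v =
  inner_disk (T u) (T v) - inner_disk (T' u) (T' v).
Proof.
move=> Hu Hv; have [HTu HT'u] := (HT Hu, HT' Hu).
rewrite (inner_disk_subl (perp_L2 (HT' HTu)) (perp_L2 (HT HT'u)) (perp_L2 Hv)).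
by rewrite (inner_adjointl HTu Hv) (adjT.2 _ _ HT'u Hv).
Qed.

(** The source of the equivalence: the form is |T u|^2 - |T' u|^2, and
    conjugating u exchanges these two norms. *)
Lemma commutator_conj u : H u ->
  inner_disk (N (fun z => (u z)^*)) (fun z => (u z)^*) =
  - inner_disk (N u) u.
Proof.
move=> Hu; have Hu' := perp_conj Hu.
rewrite !inner_commutator// !adjoint_norm// opprB.
by have -> : (fun z => ((u z)^*)^*) = u by apply/funext => z; rewrite conjCK.
Qed.

Lemma commutator_sym u v : H u -> H v ->
  inner_disk (N u) v = inner_disk u (N v).
Proof.
move=> Hu Hv; have [HNv Lu] := (perp_commutator Hv, perp_L2 Hu).
rewrite (inner_disk_conj (perp_L2 HNv) Lu) !inner_commutator// rmorphB /=.
rewrite -(inner_disk_conj (perp_L2 (HT Hv)) (perp_L2 (HT Hu))).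
by rewrite -(inner_disk_conj (perp_L2 (HT' Hv)) (perp_L2 (HT' Hu))).
Qed.

End Symmetry.
End Perp.

Theorem theorem2p2 (R : realType) (phi : R * R -> R[i])
    (hphi : Lp_disk (+oo)%E phi) :
  hyponormal (L2h_perp R) (dual_toeplitz phi) <->
  normal_operator (L2h_perp R) (dual_toeplitz phi).
Proof.
split=> -[bT [T' adjT h]]; split=> //; exists T' => // u Hu.
- have N0 v : L2h_perp R v -> inner_disk (T' (dual_toeplitz phi v) \-
      dual_toeplitz phi (T' v)) v = 0.
    move=> Hv; apply/eqP; rewrite eq_le h// andbT -oppr_ge0.
    by rewrite -(commutator_conj bT adjT Hv); exact/h/perp_conj.
  have := symmetric_form_eq0 (perp_commutator bT adjT) (commutator_sym bT adjT)
    N0 Hu.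
  by apply: ae_disk_imply => z /eqP; rewrite subr_eq0 => /eqP.
- rewrite (aeq_inner_disk0 _ (perp_L2 Hu))//.
    exact/perp_L2/(perp_commutator bT adjT).
  by have := h u Hu; apply: ae_disk_imply => z /= ->; rewrite subrr.
Qed.
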